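(* Let $\mathcal{A} = \{\widetilde{a}_1, \widetilde{a}_2, \ldots, \widetilde{a}_m\}$ be a set of linearly independent elements in the real space $\ell_\infty^n$, where $1 < m < n$ and $\widetilde{a}_k = (a_1^k, a_2^k, \ldots, a_n^k)$ for each $1 \le k \le m$. Let $\mathbb{Y} = \operatorname{span} \mathcal{A}$. Then the following statements are equivalent: (i) $\mathbb{Y}$ is a strongly anti-coproximinal subspace of $\ell_\infty^n$; (ii) $\mathbb{Y}$ is an anti-coproximinal subspace of $\ell_\infty^n$; (iii) every component of $\mathcal{A}$ satisfies the $*$-Property and $|P_i^+ \cup P_i^-| = 1$ for all $1 \le i \le n$.
   Context: For $i \in \{1, \ldots, n\}$, the $i$-th component of $\mathcal{A}$ is $(a_i^1, a_i^2, \ldots, a_i^m)$. Put $P_i^+ = \{j \in \{1,\ldots,n\} : (a_i^1, \ldots, a_i^m) = (a_j^1, \ldots, a_j^m)\}$ and $P_i^- = \{j \in \{1,\ldots,n\} : (a_i^1, \ldots, a_i^m) = -(a_j^1, \ldots, a_j^m)\}$. The $i$-th component satisfies the $*$-Property if there exist $\beta_1, \ldots, \beta_m \in \mathbb{R}$ such that $\left|\sum_{k=1}^m \beta_k a_i^k\right| > \max\left\{\left|\sum_{k=1}^m \beta_k a_j^k\right| : j \in \{1,\ldots,n\} \setminus (P_i^+ \cup P_i^-)\right\}$. Let $\mathbb{Y}$ be a subspace of a real Banach space $\mathbb{X}$. An element $y_0 \in \mathbb{Y}$ is a best coapproximation to $x \in \mathbb{X}$ out of $\mathbb{Y}$ if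 $\|y_0 - y\| \le \|x - y\|$ for all $y \in \mathbb{Y}$. For $\epsilon \in [0,1)$, $x \perp_B^{\epsilon} y$ means $\|x + \lambda y\|^2 \ge \|x\|^2 - 2\epsilon \|x\| \|\lambda y\|$ for all $\lambda \in \mathbb{R}$ (it is known that this is equivalent to $\|x+\lambda y\| \ge \|x\| - \epsilon\|\lambda y\|$ for all $\lambda \in \mathbb{R}$); $y_0 \in \mathbb{Y}$ is an $\epsilon$-best coapproximation to $x$ out of $\mathbb{Y}$ if $y \perp_B^{\epsilon} (x - y_0)$ for all $y \in \mathbb{Y}$. $\mathbb{Y}$ is anti-coproximinal in $\mathbb{X}$ if no $x \in \mathbb{X} \setminus \mathbb{Y}$ has a best coapproximation out of $\mathbb{Y}$; it is strongly anti-coproximinal in $\mathbb{X}$ if for every $x \in \mathbb{X} \setminus \mathbb{Y}$ and every $\epsilon \in [0,1)$ there is no $\epsilon$-best coapproximation to $x$ out of $\mathbb{Y}$. *)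

(* Defs.v *)
From HB Require Import structures.
From mathcomp Require Import all_boot all_order all_algebra.
From mathcomp Require Import all_classical all_reals all_analysis.

Set Implicit Arguments.
Unset Strict Implicit.
Unset Printing Implicit Defensive.

Import Order.TTheory GRing.Theory Num.Theory.
Import numFieldNormedType.Exports.

Local Open Scope ring_scope.

(* The library norm of 'rV[R]_n is the maximum of the absolute values of the
   entries, so this makes \ell_\infty^n a real Banach space; the library has
   both the norm and the completeness, but not their join. *)
HB.instance Definition _ (R : realType) (m n : nat) :=
  Uniform_isComplete.Build 'M[R]_(m, n) cauchy_cvg.

Definition best_coapproximation (R : realType) (X : completeNormedModType R)
    (Y : submodClosed X) (x y0 : X) : Prop :=
  y0 \in Y /\ forall y, y \in Y -> `|y0 - y| <= `|x - y|.

(* x \perp_B^eps y *)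
Definition eps_birkhoff_orthogonal (R : realType)
    (X : completeNormedModType R) (eps : R) (x y : X) : Prop :=
  forall lambda : R,
    `|x + lambda *: y| ^+ 2 >= `|x| ^+ 2 - 2 * eps * `|x| * `|lambda *: y|.

Definition eps_best_coapproximation (R : realType)
    (X : completeNormedModType R) (Y : submodClosed X) (eps : R)
    (x y0 : X) : Prop :=
  y0 \in Y /\
  forall y, y \in Y -> eps_birkhoff_orthogonal eps y (x - y0).

Definition anti_coproximinal (R : realType) (X : completeNormedModType R)
    (Y : submodClosed X) : Prop :=
  forall x, x \notin Y -> ~ exists y0, best_coapproximation Y x y0.

Definition strongly_anti_coproximinal (R : realType)
    (X : completeNormedModType R) (Y : submodClosed X) : Prop :=
  forall x, x \notin Y -> forall eps : R, 0 <= eps -> eps < 1 ->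
    ~ exists y0, eps_best_coapproximation Y eps x y0.

Section Components.
Variables (R : realType) (m n : nat) (a : m.-tuple 'rV[R]_n).

Definition component (i : 'I_n) : 'rV[R]_m := \row_k tnth a k 0 i.

Definition Pplus (i : 'I_n) : {set 'I_n} :=
  [set j | component i == component j].

Definition Pminus (i : 'I_n) : {set 'I_n} :=
  [set j | component i == - component j].

(* The default 0 of the maximum only matters when every component is
   plus or minus the i-th one, which is impossible when the tuple is free
   and 1 < m. *)
Definition star_property (i : 'I_n) : Prop :=
  exists beta : 'I_m -> R,
    `|\sum_k beta k * component i 0 k| >
    \big[Num.max/0]_(j in ~: (Pplus i :|: Pminus i))
       `|\sum_k beta k * component j 0 k|.

End Components.

(* Main.v *)
Require Import Defs.
From HB Require Import structures.
From mathcomp Require Import all_boot all_order all_algebra.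
From mathcomp Require Import all_classical all_reals all_analysis.
From mathcomp Require Import lra.

Set Implicit Arguments.
Unset Strict Implicit.
Unset Printing Implicit Defensive.

Import Order.TTheory GRing.Theory Num.Theory.
Import numFieldNormedType.Exports.

Local Open Scope ring_scope.

(* Condition (iii) says exactly that for every coordinate i some y in Y peaks
   at i, i.e. |y_i| > |y_j| for all j <> i.
   If no y in Y peaks at i, deleting the i-th coordinate preserves the norm on
   Y, so the unit vector e_i, which does peak at i and hence lies outside Y,
   has the best coapproximation 0.
   Conversely, let z = x - y0 <> 0 attain its norm at i and let y in Y peak at
   i.  Moving y along z so as to shrink y_i decreases the norm of y by
   |lambda z| for small lambda, which contradicts eps-orthogonality for every eps < 1. *)

(** The default 0 of the maximum forces [y 0 i] to be nonzero even when there is no other entry. *)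
Definition peaks_at (R : realType) (n : nat) (i : 'I_n) (y : 'rV[R]_n) : Prop :=
  \big[Num.max/0]_(j | j != i) `|y 0 j| < `|y 0 i|.

Lemma rV_entry_le_norm (R : realType) (n : nat) (x : 'rV[R]_n) (j : 'I_n) :
  `|x 0 j| <= `|x|.
Proof.
by rewrite [leRHS]/Num.norm /= mx_normrE; apply: (le_bigmax 0 _ (0, j)).
Qed.

Lemma rV_norm_le (R : realType) (n : nat) (x : 'rV[R]_n) (c : R) :
  0 <= c -> (forall j, `|x 0 j| <= c) -> `|x| <= c.
Proof.
move=> c0 xc; rewrite [leLHS]/Num.norm /= mx_normrE.
by apply: bigmax_le => // -[k j] _ /=; rewrite (ord1 k).
Qed.

Lemma rV_norm_attained (R : realType) (n : nat) (x : 'rV[R]_n) :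
  x != 0 -> exists i, `|x| = `|x 0 i|.
Proof.
rewrite -normr_eq0 => /mx_norm_neq0[[k i] /= E].
by exists i; rewrite -(ord1 k).
Qed.

Lemma peaks_at_norm (R : realType) (n : nat) (i : 'I_n) (y : 'rV[R]_n) :
  peaks_at i y -> `|y| = `|y 0 i|.
Proof.
move=> /bigmax_ltP[_ yi]; apply/eqP; rewrite eq_le rV_entry_le_norm andbT.
apply: rV_norm_le => // j.
by have [->//|/yi/ltW] := eqVneq j i.
Qed.

(** Without a peak at [i], the entries off [i] already determine the norm of [y], and adding a
    multiple of e_i leaves them unchanged. *)
Lemma norm_add_delta_ge (R : realType) (n : nat) (i : 'I_n) (y : 'rV[R]_n)
    (lambda : R) :
  ~ peaks_at i y -> `|y| <= `|y + lambda *: delta_mx 0 i|.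
Proof.
move=> /negP; rewrite -leNgt => yi.
have off j : j != i -> `|y 0 j| <= `|y + lambda *: delta_mx 0 i|.
  move=> ji; apply: le_trans (rV_entry_le_norm _ j).
  by rewrite !mxE (negPf ji) andbF mulr0 addr0.
apply: rV_norm_le => // j; have [->|/off//] := eqVneq j i.
by apply: (le_trans yi); apply: bigmax_le.
Qed.

Lemma peaks_at_delta (R : realType) (n : nat) (i : 'I_n) :
  peaks_at i (delta_mx 0 i : 'rV[R]_n).
Proof.
rewrite /peaks_at; apply: bigmax_lt => [|j ji]; rewrite !mxE !eqxx normr1 //.
by rewrite (negPf ji) normr0.
Qed.

Lemma peaks_at_not_eps_orthogonal (R : realType) (n : nat) (i : 'I_n)
    (y z : 'rV[R]_n) (eps : R) :
  peaks_at i y -> z != 0 -> `|z| = `|z 0 i| -> eps < 1 ->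
  ~ eps_birkhoff_orthogonal (X := 'rV[R]_n) eps y z.
Proof.
move=> yi z0 zi eps1 orth; have Ny := peaks_at_norm yi.
set B := \big[Num.max/0]_(j | j != i) `|y 0 j|.
have B0 : 0 <= B by apply: bigmax_ge_id.
have BN : B < `|y| by rewrite Ny.
have N0 : 0 < `|y| by apply: le_lt_trans BN.
have zi0 : z 0 i != 0 by rewrite -normr_eq0 -zi normr_eq0.
(* The bound by [1 - eps] serves the final contradiction; the other one gives B + t |y| <= (1 - t)
   |y|, which controls the entries off [i]. *)
have [t [t0 t_eps t_gap]] :
    exists t : R, [/\ 0 < t, t <= 1 - eps & 2 * (t * `|y|) <= `|y| - B].
  exists (Num.min (1 - eps) ((`|y| - B) / (2 * `|y|))); split.
  - by rewrite lt_min subr_gt0 eps1 divr_gt0 ?subr_gt0 ?mulr_gt0.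
  - by rewrite ge_min lexx.
  - by rewrite mulrCA -ler_pdivlMr ?mulr_gt0 // ge_min lexx orbT.
pose lambda := - (t * y 0 i / z 0 i).
have Nlz : `|lambda *: z| = t * `|y|.
  rewrite normrZ zi normrN !normrM normfV mulfVK ?normr_eq0 // -Ny.
  by rewrite (gtr0_norm t0).
have t1 : t <= 1 by rewrite -(ler_pM2r N0) mul1r; lra.
(* lambda z has i-th entry - t y_i, so y_i is scaled by 1 - t, while the gap
   |y| - B absorbs the growth of the other entries. *)
have shrink : `|y + lambda *: z| <= (1 - t) * `|y|.
  apply: rV_norm_le => [|j]; first by rewrite mulr_ge0 // subr_ge0.
  have [->|ji] := eqVneq j i.
    rewrite !mxE mulNr mulfVK // -{1}[y 0 i]mul1r -mulrBl normrM -Ny.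
    by rewrite ger0_norm ?subr_ge0.
  rewrite mxE; apply: (le_trans (ler_normD _ _)).
  have yj : `|y 0 j| <= B by apply: (le_bigmax_cond 0 (fun j => `|y 0 j|) ji).
  have := rV_entry_le_norm (lambda *: z) j; rewrite Nlz; lra.
have := orth lambda; rewrite Nlz => H.
have H2 : `|y + lambda *: z| ^+ 2 <= ((1 - t) * `|y|) ^+ 2.
  by rewrite ler_sqr ?nnegrE ?(le_trans _ shrink).
have {H2}H := le_trans H H2.
(* This is |y|^2 - 2 eps t |y|^2 <= (1 - t)^2 |y|^2 rearranged; it forces t >= 2 (1 - eps), against
   0 < t <= 1 - eps. *)
have : 0 <= (t * `|y| ^+ 2) * (t - 2 * (1 - eps)) by nra.
rewrite pmulr_rge0 ?mulr_gt0 ?exprn_gt0 // => H3; lra.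
Qed.

(** Trades the coefficients [beta] in [star_property] for a vector of the span. *)
Lemma mem_span_tuple (R : realType) (m n : nat) (a : m.-tuple 'rV[R]_n)
    (P : 'rV[R]_n -> Prop) :
  (exists2 y, y \in <<a>>%VS & P y) <->
  exists beta : 'I_m -> R, P (\sum_k beta k *: tnth a k).
Proof.
split=> [[y /coord_span ya Py]|[beta Pb]].
  exists (coord a ^~ y); move: Py; rewrite {1}ya.
  by under eq_bigr do rewrite -tnth_nth.
exists (\sum_k beta k *: tnth a k) => //.
by apply: memv_suml => k _; rewrite memvZ // memv_span // mem_tnth.
Qed.

Lemma sum_component (R : realType) (m n : nat) (a : m.-tuple 'rV[R]_n)
    (beta : 'I_m -> R) (j : 'I_n) :
  \sum_k beta k * component a j 0 k = (\sum_k beta k *: tnth a k) 0 j.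
Proof. by rewrite summxE; apply: eq_bigr => k _; rewrite !mxE. Qed.

(** The entry y_j is a linear form in the j-th component, with coefficients independent of j, so
    equal or opposite components give equal or opposite entries. *)
Lemma norm_entry_Pplusminus (R : realType) (m n : nat) (a : m.-tuple 'rV[R]_n)
    (i j : 'I_n) (y : 'rV[R]_n) :
  y \in <<a>>%VS -> j \in Pplus a i :|: Pminus a i -> `|y 0 j| = `|y 0 i|.
Proof.
move=> /coord_span ->; under eq_bigr do rewrite -tnth_nth.
rewrite -!sum_component !inE => /orP[]/eqP -> //.
by under [in RHS]eq_bigr do rewrite mxE mulrN; rewrite sumrN normrN.
Qed.

(** If the index set is {i}, the maximum in [star_property] runs over all j <> i and the inequality
    is a peak at [i]. Conversely, a peak at [i] rules out any other j in that set, since such a j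
    would give |y_j| = |y_i|. *)
Lemma star_property_peak (R : realType) (m n : nat) (a : m.-tuple 'rV[R]_n)
    (i : 'I_n) :
  (star_property a i /\ #|Pplus a i :|: Pminus a i| = 1%N) <->
  exists2 y, y \in <<a>>%VS & peaks_at i y.
Proof.
have iP : i \in Pplus a i :|: Pminus a i by rewrite !inE eqxx.
have starE : Pplus a i :|: Pminus a i = [set i] ->
    star_property a i <-> exists2 y, y \in <<a>>%VS & peaks_at i y.
  move=> Pi; rewrite mem_span_tuple /star_property /peaks_at Pi.
  have E beta : \big[Num.max/0]_(j in ~: [set i])
       `|\sum_k beta k * component a j 0 k| =
     \big[Num.max/0]_(j | j != i) `|(\sum_k beta k *: tnth a k) 0 j|.
    by apply: eq_big => [j|j _]; rewrite ?inE ?sum_component.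
  by split=> -[beta H]; exists beta; move: H; rewrite E sum_component.
split=> [[st /eqP/cards1P[k Pk]]|pk].
  by apply/starE => //; move: iP; rewrite Pk inE => /eqP ->.
have Pi : Pplus a i :|: Pminus a i = [set i].
  have [y ya /bigmax_ltP[_ yi]] := pk.
  apply/eqP; rewrite finset.eqEsubset finset.sub1set iP andbT.
  apply/fintype.subsetP => j jP; rewrite inE; apply: contraT => /yi.
  by rewrite (norm_entry_Pplusminus ya jP) ltxx.
by rewrite starE // Pi cards1.
Qed.

Lemma best_coapproximation_eps0 (R : realType) (X : completeNormedModType R)
    (Y : submodClosed X) (x y0 : X) :
  best_coapproximation Y x y0 -> eps_best_coapproximation Y 0 x y0.
Proof.
move=> [y0Y coapp]; split=> // y yY lambda.
rewrite mulr0 !mul0r subr0 ler_sqr ?nnegrE //.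
have [->|l0] := eqVneq lambda 0; first by rewrite scale0r addr0.
(* Testing coapproximation against y0 - y / lambda and scaling by |lambda| yields |y| <= |y + lambda
   (x - y0)|. *)
have wY : y0 + (- lambda^-1) *: y \in Y by apply: rpredD => //; apply: rpredZ.
have := coapp _ wY; rewrite scaleNr subKr.
have -> : x - (y0 - lambda^-1 *: y) = lambda^-1 *: (y + lambda *: (x - y0)).
  by rewrite scalerDr scalerA mulVf // scale1r opprB addrCA.
by rewrite !normrZ ler_pM2l // normr_gt0 invr_eq0.
Qed.

Theorem theorem2p25 (R : realType) (m n : nat) (a : m.-tuple 'rV[R]_n)
    (lt1m : (1 < m)%N) (ltmn : (m < n)%N) (free_a : free a) :
  [<-> strongly_anti_coproximinal (X := 'rV[R]_n) <<a>>%VS;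
       anti_coproximinal (X := 'rV[R]_n) <<a>>%VS;
       forall i : 'I_n,
         star_property a i /\ #|Pplus a i :|: Pminus a i| = 1%N].
Proof.
tfae.
- move=> strong x xY [y0 /best_coapproximation_eps0 coapp].
  by apply: (strong x xY 0) => //; exists y0.
- move=> anti i; apply/star_property_peak; apply: contrapT => nopeak.
  have Ypeak y : y \in <<a>>%VS -> ~ peaks_at i y.
    by move=> yY yi; apply: nopeak; exists y.
  apply: (anti (delta_mx 0 i)).
    by apply/negP => /Ypeak; apply; apply: peaks_at_delta.
  exists 0; split=> [|y yY]; first exact: mem0v.
  (* The distance from e_i to y is the norm of y + lambda e_i at lambda = -1. *)
  rewrite sub0r normrN distrC -scaleN1r.
  exact/norm_add_delta_ge/Ypeak.
- move=> peaks x xY eps _ eps1 [y0 [y0Y orth]].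
  have z0 : x - y0 != 0 by apply: contraNneq xY => /subr0_eq ->.
  (* The coordinate [i] depends on [x] and [y0], so a peak must be available at every coordinate. *)
  have [i zi] := rV_norm_attained z0.
  have /star_property_peak[y yY yi] := peaks i.
  exact: (peaks_at_not_eps_orthogonal yi z0 zi eps1 (orth y yY)).
Qed.
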